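(* Let $A$ be a Zinbiel algebra over $F$ with a derivation $D$. Put $a\star b=D(a)b-aD(b)$, $a\circ b = a b+b a$ and $[a, b]=a\star b-b\star a$ for $a,b\in A$. Then $(A,\circ,[\,,],D)$ is a generalized Poisson algebra and a transposed Poisson algebra.
   Context: The base field $F$ is algebraically closed of characteristic $0$. A Zinbiel algebra is a vector space $A$ with a bilinear product $(a,b)\mapsto ab$ satisfying $(ab+ba)c=a(bc)$ for all $a,b,c\in A$. A derivation of an algebra is a linear map satisfying the Leibniz (product) rule with respect to its multiplication; in particular $D(ab)=D(a)b+aD(b)$. $(A,\circ,[\,,],D)$ is a generalized Poisson algebra if $(A,\circ)$ is a commutative associative algebra (not assumed unital), $(A,[\,,])$ is a Lie algebra, $D$ is a derivation of both $(A,\circ)$ and $(A,[\,,])$, and for all $a,b,c\in A$ $$[a \circ b, c] = a\circ [b, c]+[a, c]\circ b + a\circ b\circ D(c).$$ $(A,\circ,[\,,])$ (or $(A,\circ,[\,,],D)$) is a transposed Poisson algebra if $(A,\circ)$ is a commutative associative algebra, $(A,[\,,])$ is a Lie algebra, and for all $a,b,c\in A$ $$2a\circ [b,c] = [a\circ b,c] + [b,a\circ c].$$ *)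

(* Defs.v *)
From HB Require Import structures.
From mathcomp Require Import all_boot all_order all_algebra.

Set Implicit Arguments.
Unset Strict Implicit.
Unset Printing Implicit Defensive.

Import GRing.Theory.
Local Open Scope ring_scope.

(* Algebras here need not be associative, unital or finite-dimensional, and
   one vector space carries several products: an algebra structure is a
   bilinear operation on an lmodType, and each class of algebras is a predicate
   on such operations that includes bilinearity. *)

Section Algebras.
Variables (F : fieldType) (A : lmodType F).
Implicit Types (mul br : A -> A -> A) (D : A -> A).

Definition is_algebra mul : Prop := bilinear_for *:%R *:%R mul.

Definition is_derivation mul D : Prop :=
  linear D /\ forall a b : A, D (mul a b) = mul (D a) b + mul a (D b).

Record is_zinbiel mul : Prop := IsZinbiel {
  zinbiel_algebra : is_algebra mul;
  zinbiel_identity : forall a b c : A,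
    mul (mul a b + mul b a) c = mul a (mul b c) }.

Record is_comm_assoc mul : Prop := IsCommAssoc {
  comm_assoc_algebra : is_algebra mul;
  comm_assoc_comm : commutative mul;
  comm_assoc_assoc : associative mul }.

Record is_lie br : Prop := IsLie {
  lie_algebra : is_algebra br;
  lie_alternating : forall a : A, br a a = 0;
  lie_jacobi : forall a b c : A,
    br a (br b c) + br b (br c a) + br c (br a b) = 0 }.

Record is_generalized_poisson mul br D : Prop := IsGeneralizedPoisson {
  gpoisson_comm_assoc : is_comm_assoc mul;
  gpoisson_lie : is_lie br;
  gpoisson_derivation_mul : is_derivation mul D;
  gpoisson_derivation_br : is_derivation br D;
  gpoisson_identity : forall a b c : A,
    br (mul a b) c =
      mul a (br b c) + mul (br a c) b + mul (mul a b) (D c) }.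

Record is_transposed_poisson mul br : Prop := IsTransposedPoisson {
  tpoisson_comm_assoc : is_comm_assoc mul;
  tpoisson_lie : is_lie br;
  tpoisson_identity : forall a b c : A,
    2%:R *: mul a (br b c) = br (mul a b) c + br b (mul a c) }.

Definition star mul D (a b : A) : A := mul (D a) b - mul a (D b).

Definition anticommutator mul (a b : A) : A := mul a b + mul b a.

Definition commutator mul (a b : A) : A := mul a b - mul b a.

End Algebras.

(* Main.v *)
Require Import Defs.
From HB Require Import structures.
From mathcomp Require Import all_boot all_order all_algebra.

Set Implicit Arguments.
Unset Strict Implicit.
Unset Printing Implicit Defensive.

Import GRing.Theory.
Local Open Scope ring_scope.

(** Write x' for [D x], o for the anticommutator and [a, b] for the bracket. The
    statement factors through commutative algebra.
    By the Zinbiel identity the anticommutator is associative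
    ([zinbiel_comm_assoc]), and every derivation of a product is one of its
    anticommutator. Regrouping the four terms of the commutator of [star]
    gives [a, b] = a' o b - a o b', that is, [star] computed with the
    anticommutator in place of the original product
    ([commutator_star_anticommutator]).

    So the bracket is the Wronskian bracket of a commutative associative
    algebra with a derivation. After expansion by the Leibniz rule, the axioms
    involving that bracket are linear relations between products of iterated
    derivatives of a, b and c, each of which is symmetric in its
    factors; they are checked by matching these products
    ([wronskian_derivation], [wronskian_jacobi],
    [wronskian_generalized_poisson], [wronskian_transposed_poisson]). *)

Section AlgebraTheory.
Variables (F : fieldType) (A : lmodType F) (mul : A -> A -> A).
Hypothesis mul_algebra : is_algebra mul.

Lemma algebra_mulDl a b c : mul (a + b) c = mul a c + mul b c.
Proof. by have := mul_algebra.1 c 1 a b; rewrite /= !scale1r. Qed.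

Lemma algebra_mulDr a b c : mul a (b + c) = mul a b + mul a c.
Proof. by have := mul_algebra.2 a 1 b c; rewrite /= !scale1r. Qed.

Lemma algebra_mulBl a b c : mul (a - b) c = mul a c - mul b c.
Proof. by apply/eqP; rewrite eq_sym subr_eq -algebra_mulDl subrK. Qed.

Lemma algebra_mulBr a b c : mul a (b - c) = mul a b - mul a c.
Proof. by apply/eqP; rewrite eq_sym subr_eq -algebra_mulDr subrK. Qed.

Lemma anticommutator_algebra : is_algebra (anticommutator mul).
Proof.
by split=> [c k a b|a k b c];
  rewrite /anticommutator /= mul_algebra.1 mul_algebra.2 /= scalerDr addrACA.
Qed.

Lemma anticommutator_comm : commutative (anticommutator mul).
Proof. by move=> a b; rewrite /anticommutator addrC. Qed.

Lemma anticommutator_derivation D :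
  is_derivation mul D -> is_derivation (anticommutator mul) D.
Proof.
move=> [D_lin D_leibniz]; split=> // a b; rewrite /anticommutator.
have D_add x y : D (x + y) = D x + D y.
  by have := D_lin 1 x y; rewrite !scale1r.
by rewrite D_add !D_leibniz [mul (D b) a + _]addrC addrACA.
Qed.

Lemma commutator_star_anticommutator D a b :
  commutator (star mul D) a b = star (anticommutator mul) D a b.
Proof. by rewrite /commutator /star /anticommutator opprB opprD addrACA. Qed.

End AlgebraTheory.

(** The products a(bc) of a Zinbiel algebra are symmetric in [a] and [b],
    because (ab + ba)c is; both bracketings of [a], [b], [c] in the
    anticommutator are then sums of the same three products. *)
Lemma zinbiel_comm_assoc (F : fieldType) (A : lmodType F)
    (mul : A -> A -> A) :
  is_zinbiel mul -> is_comm_assoc (anticommutator mul).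
Proof.
move=> [mul_alg mul_zinb]; split.
- exact: anticommutator_algebra.
- exact: anticommutator_comm.
have mulCA x y z : mul x (mul y z) = mul y (mul x z).
  by rewrite -!mul_zinb addrC.
move=> a b c.
rewrite [RHS]/anticommutator [LHS]anticommutator_comm /anticommutator.
rewrite !mul_zinb !(algebra_mulDr mul_alg).
by rewrite [mul c (mul a b)]mulCA [mul c (mul b a)]mulCA addrC addrA.
Qed.

Section WronskianBracket.
Variables (F : fieldType) (A : lmodType F).
Variables (mul br : A -> A -> A) (D : A -> A).
Hypothesis mul_ca : is_comm_assoc mul.
Hypothesis D_der : is_derivation mul D.
(* A pointwise equation lets [br] be the commutator of another product without
   an appeal to functional extensionality. *)
Hypothesis br_wronskian : forall a b, br a b = star mul D a b.

Let mul_alg : is_algebra mul := comm_assoc_algebra mul_ca.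
Let mulC : commutative mul := comm_assoc_comm mul_ca.
Let mulA : associative mul := comm_assoc_assoc mul_ca.
Let mulDl := algebra_mulDl mul_alg.
Let mulDr := algebra_mulDr mul_alg.
Let mulBl := algebra_mulBl mul_alg.
Let mulBr := algebra_mulBr mul_alg.

Let mulCA a b c : mul a (mul b c) = mul b (mul a c).
Proof. by rewrite !mulA (mulC a). Qed.

Let mulAC a b c : mul (mul a b) c = mul (mul a c) b.
Proof. by rewrite -!mulA (mulC b). Qed.

Let derivationB a b : D (a - b) = D a - D b.
Proof.
have D_add x y : D (x + y) = D x + D y.
  by have := D_der.1 1 x y; rewrite !scale1r.
by apply/eqP; rewrite eq_sym subr_eq -D_add subrK.
Qed.

Let derivationM a b : D (mul a b) = mul (D a) b + mul a (D b).
Proof. exact: D_der.2. Qed.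

Let brE a b : br a b = mul (D a) b - mul a (D b).
Proof. exact: br_wronskian. Qed.

Lemma wronskian_algebra : is_algebra br.
Proof.
split=> [c k a b|a k b c]; rewrite /= !brE D_der.1.
  by rewrite !mul_alg.1 /= scalerBr opprD addrACA.
by rewrite !mul_alg.2 /= scalerBr opprD addrACA.
Qed.

(** The product a' o b' cancels inside D [a, b], and again between [a', b] and
    [a, b'], so that both sides reduce to a'' o b - a o b''. *)
Lemma wronskian_derivation : is_derivation br D.
Proof.
split=> [|a b]; first exact: D_der.1.
by rewrite !brE derivationB !derivationM addrKA subrKA.
Qed.

(** Since [b, c]' = b'' o c - b o c'', the double bracket
    [a, [b, c]] = a' o [b, c] - a o [b, c]' is a difference of two pairs of
    monomials: one pair with two factors differentiated once, one pair with a
    single factor differentiated twice. Under cyclic permutation of the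
    letters each pair telescopes on its own. *)
Lemma wronskian_jacobi a b c :
  br a (br b c) + br b (br c a) + br c (br a b) = 0.
Proof.
have double x y z : br x (br y z) =
    (mul (mul (D x) (D y)) z - mul (mul (D z) (D x)) y) -
    (mul (mul x (D (D y))) z - mul (mul x y) (D (D z))).
  rewrite !brE derivationB !derivationM addrKA !mulBr !mulA.
  by rewrite [mul (D z) (D x)]mulC [mul (mul (D x) y) (D z)]mulAC.
have sum_sub (p q r u v w : A) :
    p - u + (q - v) + (r - w) = p + q + r - (u + v + w).
  by rewrite [p - u + (q - v)]addrACA [LHS]addrACA !opprD.
have telescope (x y z : A) : (x - y) + (y - z) + (z - x) = 0.
  by rewrite !subrKA subrr.
rewrite !double sum_sub [X in X - _]addrAC telescope.
have -> : mul (mul b (D (D c))) a = mul (mul a b) (D (D c)).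
  by rewrite [LHS]mulC mulA.
have -> : mul (mul b c) (D (D a)) = mul (mul c (D (D a))) b.
  by rewrite -mulA [LHS]mulC.
have -> : mul (mul c a) (D (D b)) = mul (mul a (D (D b))) c.
  by rewrite -mulA [LHS]mulC.
by rewrite telescope subrr.
Qed.

Lemma wronskian_lie : is_lie br.
Proof.
split; [exact: wronskian_algebra| |exact: wronskian_jacobi].
by move=> a; rewrite brE [mul a _]mulC subrr.
Qed.

(** The bracket is a derivation in its first argument up to the term
    a o b o c', which occurs once with a minus sign on the left and twice on
    the right: the last summand of the identity is this excess. *)
Lemma wronskian_generalized_poisson : is_generalized_poisson mul br D.
Proof.
split=> //; [exact: wronskian_lie|exact: wronskian_derivation|move=> a b c].
rewrite !brE derivationM mulDl mulBr mulBl !mulA.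
rewrite [mul (mul (D a) c) b]mulAC [mul (mul a (D c)) b]mulAC.
by rewrite -[RHS]addrA subrK [RHS]addrC addrA.
Qed.

(** On the right a' o b o c occurs with both signs and cancels, while the two
    monomials of a o [b, c] occur twice each. *)
Lemma wronskian_transposed_poisson : is_transposed_poisson mul br.
Proof.
split=> //; [exact: wronskian_lie|move=> a b c].
rewrite !brE !derivationM scaler_nat mulr2n.
rewrite mulBr mulDl mulDr -!mulA [mul (D b) (mul a c)]mulCA.
rewrite [mul b (mul (D a) c)]mulCA [mul b (mul a (D c))]mulCA.
have regroup (p q w : A) : (q - w) + (q - w) = (p + q - w) + (q - (p + w)).
  by rewrite [p + q]addrC opprD -[q + p - w]addrA [RHS]addrACA
             [p - w + _]addrACA subrr add0r addrACA.
exact: regroup.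
Qed.

End WronskianBracket.

Theorem corollary2p4 (F : closedFieldType) (F_char0 : [pchar F] =i pred0)
    (A : lmodType F) (mul : A -> A -> A) (D : A -> A)
    (mul_zinbiel : is_zinbiel mul) (D_der : is_derivation mul D) :
  is_generalized_poisson
    (anticommutator mul) (commutator (star mul D)) D /\
  is_transposed_poisson
    (anticommutator mul) (commutator (star mul D)).
Proof.
have circ_ca := zinbiel_comm_assoc mul_zinbiel.
have D_der_circ := anticommutator_derivation D_der.
have brE := commutator_star_anticommutator mul D.
by split; [apply: wronskian_generalized_poisson
          |apply: wronskian_transposed_poisson D_der_circ _].
Qed.
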